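(* Let $q$ be a prime power, $k\geq 2$, and $n=p_z^{e_z}\cdots p_1^{e_1}k$, where $p_1>\cdots>p_z$ are distinct odd primes and $e_1,\dots,e_z\geq 1$; set $\ell_j=\frac{p_j-3}{2}$ for $j=1,\dots,z$. Let ${_{p_z^{e_z}\cdots p_1^{e_1}}}\mathcal{C}_k\subseteq\mathcal{G}_q(n,k)$ be the code constructed as follows. (Building block.) For an odd prime $p$ and an integer $m\geq 2$, let $\ell=\frac{p-3}{2}$, let $\omega$ be a primitive element of $\mathbb{F}_{q^m}$ and $\gamma\in\mathbb{F}_{q^{pm}}$ with $\mathbb{F}_{q^m}(\gamma)=\mathbb{F}_{q^{pm}}$. For $0\leq\ell_0\leq\ell$ and $\underline{\alpha}=(\alpha_1,\dots,\alpha_{\ell_0})$ with $\alpha_1,\dots,\alpha_{\ell_0-1}\in\mathbb{F}_{q^m}$, $\alpha_{\ell_0}\in\mathbb{F}_{q^m}^*$ (empty tuple if $\ell_0=0$), put $P_{\underline{\alpha}}(\gamma)=1+\alpha_1\gamma+\cdots+\alpha_{\ell_0}\gamma^{\ell_0}$. For every index $\underline{h}=(\underline{\alpha},a,j,\ell_1)$ with $a\in\mathbb{F}_{q^m}$, $0\leq j\leq q-2$, $\ell_0\leq \ell_1\leq\ell$, consider the injective $\mathbb{F}_q$-linear map $\Phi_{\underline h}:\mathbb{F}_{q^m}\to\mathbb{F}_{q^{pm}}$, $u\mapsto uP_{\underline{\alpha}}(\gamma)+\omega^j(u^q+au)\gamma^{\ell_1+1}$, and $V_{\underline h}=\mathrm{Im}(\Phi_{\underline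 h})$. Let ${_p}\mathcal{C}_m\subseteq\mathcal{G}_q(pm,m)$ be the union over all $\ell_0\in\{0,\dots,\ell\}$ and all such $\underline h$ of the orbits $\mathrm{Orb}(V_{\underline h})=\{\beta V_{\underline h}:\beta\in\mathbb{F}_{q^{pm}}^*\}$. (Nesting operation $\odot$.) If $\mathcal{C}_1\subseteq\mathcal{G}_q(m,k')$ is a cyclic subspace code with codewords $U_1,\dots,U_t$, and $\mathcal{C}_2=\bigcup_{h}\mathrm{Orb}(V_{2,h})\subseteq\mathcal{G}_q(rm,m)$ where each $V_{2,h}=\mathrm{Im}(\Phi_{2,h})$ for an injective $\mathbb{F}_q$-linear map $\Phi_{2,h}:\mathbb{F}_{q^m}\to\mathbb{F}_{q^{rm}}$, define $\mathcal{C}_2\odot\mathcal{C}_1=\bigcup_h\bigcup_{i=1}^t\mathrm{Orb}(\Phi_{2,h}(U_i))\subseteq\mathcal{G}_q(rm,k')$, and iteratively $\mathcal{C}_e\odot\cdots\odot\mathcal{C}_1=\mathcal{C}_e\odot(\mathcal{C}_{e-1}\odot\cdots\odot\mathcal{C}_1)$. (For codes obtained this way, the orbit representatives are again images of injective $\mathbb{F}_q$-linear maps, namely compositions of the maps $\Phi$ above, each pre-multiplied by a nonzero field element, so the operation can be iterated.) (The code.) For $j=1,\dots,z$ let $N_j=\prod_{h=1}^{j-1}p_h^{e_h}k$ (so $N_1=k$) and ${_{p_j^{e_j}}}\mathcal{C}_{N_j}=\bigodot_{i=1}^{e_j}{_{p_j}}\mathcal{C}_{p_j^{i-1}N_j}\subseteq\mathcal{G}_q(p_j^{e_j}N_j,N_j)$;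 then ${_{p_z^{e_z}\cdots p_1^{e_1}}}\mathcal{C}_k={_{p_z^{e_z}}}\mathcal{C}_{N_z}\odot\cdots\odot{_{p_2^{e_2}}}\mathcal{C}_{N_2}\odot{_{p_1^{e_1}}}\mathcal{C}_{N_1}$. Then ${_{p_z^{e_z}\cdots p_1^{e_1}}}\mathcal{C}_k$ is a multi-orbit cyclic subspace code in $\mathcal{G}_q(n,k)$ of cardinality \[ \left\lvert{_{p_z^{e_z}\cdots p_1^{e_1}}}\mathcal{C}_k\right\rvert=\prod_{j=1}^{z}\prod_{i_j=1}^{e_j}\left(\frac{q^{p_j^{i_j-1}\prod_{h=1}^{j-1}p_h^{e_h}k}\left(q^{(\ell_j+1)p_j^{i_j-1}\prod_{h=1}^{j-1}p_h^{e_h}k}-1\right)\left(q^{p_j^{i_j}\prod_{h=1}^{j-1}p_h^{e_h}k}-1\right)}{q^{p_j^{i_j-1}\prod_{h=1}^{j-1}p_h^{e_h}k}-1}\right) \] and minimum distance $2k-2$.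
   Context: Subspace distance $d(U,V)=\dim(U+V)-\dim(U\cap V)$ on $\mathbb{F}_q$-subspaces of $\mathbb{F}_{q^n}$; $\mathcal{G}_q(n,k)$ is the set of $k$-dimensional $\mathbb{F}_q$-subspaces of $\mathbb{F}_{q^n}$; a cyclic subspace code is a union of orbits $\mathrm{Orb}(V)=\{\alpha V:\alpha\in\mathbb{F}_{q^n}^*\}$. Empty products equal $1$. *)

(* Defs.v *)
From HB Require Import structures.
From mathcomp Require Import all_boot all_order all_algebra all_field.
Set Implicit Arguments. Unset Strict Implicit. Unset Printing Implicit Defensive.
Import GRing.Theory.
Local Open Scope ring_scope.

(* F plays the role of F_q (q := #|F|), L the role of F_{q^n} (n := \dim {:L}).
   fL L is the same field, with its canonical finType structure. *)
Notation fL L := (finvect_type L).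

Section Code.
Variables (F : finFieldType) (L : fieldExtType F).
Local Notation q := #|F|.
Local Notation K := (finvect_type L).

(* the subfield F_{q^m} of F_{q^n} (for m | n), as an F_q-subspace *)
Definition subF (m : nat) : {vspace K} :=
  span [seq x <- enum K | x ^+ (q ^ m) == x].

Definition sdist (U V : {vspace K}) : nat := (\dim (U + V) - \dim (U :&: V))%N.

Definition imgv (f : K -> K) (U : {vspace K}) : {vspace K} :=
  span [seq f u | u <- enum K & u \in U].

(* Orb(V) = { b V : b in E^* }, E the ambient field F_{q^{m'}} *)
Definition orbitv (E V : {vspace K}) : seq {vspace K} :=
  [seq (<[b]> * V)%VS | b <- enum K & (b \in E) && (b != 0)].

Fixpoint seqs_of (T : Type) (s : seq T) (n : nat) : seq (seq T) :=
  if n is n'.+1 then [seq x :: t | x <- s, t <- seqs_of s n'] else [:: [::]].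

Definition Palpha (alpha : seq K) (g : K) : K :=
  1 + \sum_(i < size alpha) alpha`_i * g ^+ i.+1.

Definition Phi (w g : K) (h : seq K * K * nat * nat) (u : K) : K :=
  let: (alpha, a, j, l1) := h in
  u * Palpha alpha g + w ^+ j * (u ^+ q + a * u) * g ^+ l1.+1.

Definition block_indices (p m : nat) : seq (seq K * K * nat * nat) :=
  let l := ((p - 3) %/ 2)%N in
  let Km := [seq x <- enum K | x \in subF m] in
  flatten [seq
    [seq (hb, l1) | hb <- [seq (ha, j) | ha <- [seq (alpha, a) |
                      alpha <- [seq al <- seqs_of Km l0
                               | (al == [::]) || (last 1 al != 0)],
                      a <- Km], j <- iota 0 (q - 1)],
                    l1 <- iota l0 (l - l0).+1]
   | l0 <- iota 0 l.+1].

(* C2 (.) C1 with C2 = pC_m built with primitive element w and generator g *)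
Definition odot_block (p m : nat) (w g : K) (C1 : seq {vspace K}) : seq {vspace K} :=
  flatten [seq orbitv (subF (p * m)) (imgv (Phi w g h) U)
          | h <- block_indices p m, U <- C1].

(* the building-block levels (p_j, p_j^(i-1) N_j), innermost first *)
Definition Nj (ps es : seq nat) (k j : nat) : nat :=
  (\prod_(h < j) (nth 0%N ps h) ^ (nth 0%N es h) * k)%N.

Definition levels (ps es : seq nat) (k : nat) : seq (nat * nat) :=
  flatten [seq [seq ((nth 0%N ps j), (nth 0%N ps j) ^ i * Nj ps es k j)%N | i <- iota 0 (nth 0%N es j)]
          | j <- iota 0 (size ps)].

Fixpoint nest (lv : seq (nat * nat)) (w g : nat -> K) (t : nat)
    (C : seq {vspace K}) : seq {vspace K} :=
  if lv is (p, m) :: lv' then nest lv' w g t.+1 (odot_block p m (w t) (g t) C)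
  else C.

Definition nested_code (ps es : seq nat) (k : nat) (w g : nat -> K) :=
  nest (levels ps es k) w g 0 [:: subF k].

Definition good_choices (ps es : seq nat) (k : nat) (w g : nat -> K) : Prop :=
  forall t, (t < size (levels ps es k))%N ->
    let pm := nth (0, 0)%N (levels ps es k) t in
    (q ^ pm.2 - 1).-primitive_root (w t) /\
    g t \in subF (pm.1 * pm.2) /\
    (<<subF pm.2; g t>>)%VS = subF (pm.1 * pm.2).

End Code.

Definition card_formula (q : nat) (ps es : seq nat) (k : nat) : nat :=
  \prod_(j < size ps) \prod_(i < (nth 0%N es j))
    (let M := ((nth 0%N ps j) ^ i * \prod_(h < j) (nth 0%N ps h) ^ (nth 0%N es h) * k)%N in
     (q ^ M * (q ^ ((((nth 0%N ps j) - 3) %/ 2).+1 * M) - 1) * (q ^ ((nth 0%N ps j) * M) - 1))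
       %/ (q ^ M - 1))%N.

(* Main.v *)
(** By induction on the levels, the words of the code are k-dimensional and two
    distinct ones meet in dimension at most 1.  Suppose that [Phi_h(U)] and
    [b Phi_h'(U')] share two [F_q]-independent vectors, coming from [u1, u2] in
    [U] and [v1, v2] in [U'].  Eliminating [b] gives
    [Phi_h(u1) Phi_h'(v2) = Phi_h(u2) Phi_h'(v1)], an identity in [g] over
    [F_{q^m}] of degree at most [p - 1 < p], hence a polynomial identity.
    Its constant term says [v_i = la u_i]; the other coefficients, together with
    [u1^q u2 <> u2^q u1], force first [h = h'], then [la] and [b] in [F_q].
    Thus [dim (U :&: U') >= 2], so [U = U'] one level down.  The same argument
    shows that [(h, U, b)] is determined by [b Phi_h(U)] up to a factor in
    [F_q^*] on [b], which yields the cardinality.  The distance [2k - 2] is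
    attained by [U] and [(x2 / x1) U] for independent [x1, x2] in [U]. *)
Require Import Defs.
From HB Require Import structures.
From mathcomp Require Import all_boot all_order all_fingroup all_algebra all_solvable all_field.
From mathcomp Require Import zify ring.
Set Implicit Arguments. Unset Strict Implicit. Unset Printing Implicit Defensive.
Import GRing.Theory.
Local Open Scope ring_scope.

(** * Comparing coefficients in a cross product *)

(** The constant coefficients give [u1 * v2 = u2 * v1], which cancels the [P * P'] term. What
    remains is [A P' X^(l+1) + B P X^(l'+1) + (f1 f2' - f2 f1') X^(l+l'+2) = 0]. If [l] and [l']
    differed, the lowest coefficient would be [A] or [B] alone, both nonzero. *)
Lemma cross_product_eq (R : fieldType) (P P' : {poly R}) (l l' : nat)
    (u1 u2 v1 v2 f1 f2 f1' f2' : R) :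
  P`_0 = 1 -> P'`_0 = 1 -> (size P <= l.+1)%N -> (size P' <= l'.+1)%N ->
  (u1 *: P + f1 *: 'X^(l.+1)) * (v2 *: P' + f2' *: 'X^(l'.+1)) =
  (u2 *: P + f2 *: 'X^(l.+1)) * (v1 *: P' + f1' *: 'X^(l'.+1)) ->
  u1 * v2 = u2 * v1 /\
  (f1 * v2 - f2 * v1 != 0 -> u1 * f2' - u2 * f1' != 0 ->
   [/\ l = l', P = P', (f1 * v2 - f2 * v1) + (u1 * f2' - u2 * f1') = 0
     & f1 * f2' = f2 * f1']).
Proof.
move=> P0 P'0 sP sP' E.
have E0 : u1 * v2 = u2 * v1.
  have := congr1 (fun p : {poly R} => p`_0) E.
  by rewrite !coef0M !coefD !coefZ !coefXn P0 P'0 /= !mulr0 !addr0 !mulr1.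
split=> //.
set A := _ - _; set B := u1 * _ - _ => A0 B0.
have {}E : A *: P' * 'X^(l.+1) + B *: P * 'X^(l'.+1)
           + (f1 * f2' - f2 * f1') *: 'X^(l.+1 + l'.+1) = 0.
  transitivity ((u1 *: P + f1 *: 'X^(l.+1)) * (v2 *: P' + f2' *: 'X^(l'.+1)) -
  (u2 *: P + f2 *: 'X^(l.+1)) * (v1 *: P' + f1' *: 'X^(l'.+1))
   - (u1 * v2 - u2 * v1) *: (P * P')).
    by rewrite exprD -!mul_polyC /A /B !(polyCB, polyCM); ring.
  by rewrite E E0 !subrr scale0r subrr.
have ll' : l = l'.
  case: (ltngtP l l') => // H.
    have := congr1 (fun p : {poly R} => p`_(l.+1)) E.
    rewrite !coefD !coefMXn !coefZ coefXn ltnn subnn P'0 ltnS H mulr1 coef0.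
    rewrite (_ : (_ == _) = false) ?mulr0 ?addr0; last by lia.
    by move=> A1; rewrite A1 eqxx in A0.
  have := congr1 (fun p : {poly R} => p`_(l'.+1)) E.
  rewrite !coefD !coefMXn !coefZ coefXn ltnn subnn P0 ltnS H mulr1 coef0.
  rewrite (_ : (_ == _) = false) ?mulr0 ?addr0 ?add0r; last by lia.
  by move=> A1; rewrite A1 eqxx in B0.
subst l'.
(* After division by [X^(l+1)], degree 0 gives [A + B = 0], the degrees up to [l] give [P = P'], and
   degree [l + 1] isolates the product term. *)
have {}E : A *: P' + B *: P + (f1 * f2' - f2 * f1') *: 'X^(l.+1) = 0.
  apply: (@mulIf _ 'X^(l.+1)); first by rewrite -size_poly_eq0 size_polyXn.
  by rewrite mul0r !mulrDl -[RHS]E exprD scalerAl.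
have cE i := congr1 (fun p : {poly R} => p`_i) E.
have AB : A + B = 0.
  by have := cE 0%N; rewrite !coefD !coefZ coefXn P0 P'0 coef0 /= mulr0 !mulr1 addr0.
have PP : P = P'.
  apply/polyP => i; case: (ltnP i l.+1) => Hi; last first.
    by rewrite !nth_default // ?(leq_trans sP) ?(leq_trans sP').
  have := cE i; rewrite !coefD !coefZ coefXn coef0 (ltn_eqF Hi) mulr0 addr0.
  have -> : B = - A by rewrite -[LHS](addKr A) AB addr0.
  rewrite mulNr -mulrBr => /eqP; rewrite mulf_eq0 (negPf A0) /= subr_eq0.
  by move/eqP.
split=> //.
have := cE l.+1; rewrite !coefD !coefZ coefXn coef0 eqxx mulr1.
rewrite !(nth_default 0) // !mulr0 !add0r.
by move/eqP; rewrite subr_eq0 => /eqP.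
Qed.

(** * Subfields as fixed points of powers of Frobenius *)

Section FrobeniusSubfields.
Variables (F : finFieldType) (L : fieldExtType F).
Local Notation q := #|F|.
Local Notation K := (fL L).
Implicit Types (x y : K) (m : nat).

Lemma expfXcard (c : F) m : c ^+ (q ^ m) = c.
Proof. by elim: m => [|m IH] //; rewrite expnSr exprM IH expf_card. Qed.

(** The additive group of [F] is a [p]-group for [p] its characteristic, so [q ^ m] is a power of
    [p]; this makes [x ^+ (q ^ m)] additive. *)
Lemma pnat_card_exp m : [pchar K].-nat (q ^ m)%N.
Proof.
have [p pp pF] := finPcharP F.
have pK : p \in [pchar K] by rewrite pchar_lalg.
rewrite pnatX; apply/orP; left.
have := fin_ring_pchar_abelem pF; rewrite /= => /abelem_pgroup.
rewrite /pgroup cardsT; apply: sub_in_pnat => r _ /=.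
by rewrite inE => /eqP ->.
Qed.

Lemma exprD_card m x y : (x + y) ^+ (q ^ m) = x ^+ (q ^ m) + y ^+ (q ^ m).
Proof. exact/exprDn_pchar/pnat_card_exp. Qed.

Lemma exprZ_card m (c : F) x : (c *: x) ^+ (q ^ m) = c *: x ^+ (q ^ m).
Proof. by rewrite exprZn expfXcard. Qed.

(** Raising to [q ^ m] is [F]-linear, so its fixed points are already closed under linear
    combinations and the span adds nothing. *)
Lemma subFE m x : (x \in subF L m) = (x ^+ (q ^ m) == x).
Proof.
apply/idP/idP => [|Hx]; last by apply: memv_span; rewrite mem_filter Hx mem_enum.
move/(@coord_span _ _ _ (in_tuple _)) => ->; apply/eqP.
apply: (big_ind (fun z => z ^+ (q ^ m) = z)).
- by rewrite expr0n expn_eq0 -leqn0 leqNgt (ltnW (finNzRing_gt1 F)).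
- by move=> y z Hy Hz; rewrite exprD_card Hy Hz.
move=> i _; rewrite exprZ_card; congr (_ *: _).
have := mem_nth (0 : K) (ltn_ord i).
by rewrite mem_filter => /andP [/eqP].
Qed.

Lemma subF_is_aspace m : is_aspace (subF L m).
Proof.
rewrite /is_aspace has_algid1; last by rewrite subFE expr1n.
apply/prodvP => x y; rewrite !subFE => /eqP Hx /eqP Hy.
by rewrite exprMn Hx Hy.
Qed.

Canonical subF_aspace m : {subfield K} := ASpace (subF_is_aspace m).


Lemma dvdp_Xcard m d :
  ('X^(q ^ m) - 'X : {poly K}) %| 'X^(q ^ (m * d)) - 'X.
Proof.
elim: d => [|d IH]; first by rewrite muln0 expn0 subrr dvdp0.
rewrite mulnS addnC expnD exprM.
rewrite -[X in _ %| X](subrKA ('X^(q ^ m))) dvdp_add //.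
by rewrite subrXX dvdp_mulr.
Qed.

Lemma card_fL : #|K| = (q ^ \dim {:L})%N.
Proof. by rewrite -(card_vspace (T := K)) ; exact: esym (@card_vspacef F K _). Qed.

(** ['X^(q ^ m) - 'X] divides ['X^#|K| - 'X], the product of all ['X - x]. It therefore splits into
    distinct linear factors and has exactly [q ^ m] roots. *)
Lemma dim_subF m : (0 < m)%N -> (m %| \dim {:L})%N -> \dim (subF L m) = m.
Proof.
move=> m0 /dvdnP [d Hd].
have := dvdp_Xcard m d; rewrite mulnC -Hd -card_fL finField_genPoly.
rewrite -big_enum => /dvdp_prod_XsubC [s Hs].
have sz : size ('X^(q ^ m) - 'X : {poly K}) = (q ^ m).+1.
  rewrite size_polyDl ?size_polyXn // size_polyN size_polyX ltnS.
  exact: leq_ltn_trans m0 (ltn_expl _ (finNzRing_gt1 F)).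
have := eqp_size Hs; rewrite sz size_prod_XsubC => -[Hsz].
have : #|subF L m| = (q ^ m)%N.
  rewrite Hsz -(card_uniqP _); last by rewrite mask_uniq // enum_uniq.
  apply: eq_card => x; rewrite -(root_prod_XsubC (mask s (enum K))).
  by rewrite -(eqp_root Hs) rootE !hornerE subr_eq0 -subFE.
rewrite (card_vspace (T := K)) => /eqP.
by rewrite eqn_exp2l ?finNzRing_gt1 // => /eqP.
Qed.

End FrobeniusSubfields.

(** * Counting the indices of a building block *)

Lemma mem_seqs_of (T : eqType) (s : seq T) n t :
  (t \in seqs_of s n) = (size t == n) && all (mem s) t.
Proof.
elim: n t => [|n IH] t; first by case: t.
apply/allpairsP/idP => [[[x u] /= [xs]]|].
  by rewrite IH => /andP [/eqP su au] ->; rewrite /= su eqxx xs au.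
case: t => //= x t /andP [st /andP [xs at']].
by exists (x, t); rewrite /= IH -eqSS st xs at'.
Qed.

Lemma seqs_of_uniq (T : eqType) (s : seq T) n : uniq s -> uniq (seqs_of s n).
Proof.
move=> us; elim: n => //= n IH; apply: allpairs_uniq => //.
by move=> [x u] [y v] _ _ /= [-> ->].
Qed.

(** The default [x0] is arbitrary because prepending [x] to a sequence turns the default of [last]
    into [x], which is how the induction proceeds. *)
Lemma count_last_neq0 (V : nmodType) (x0 : V) (s : seq V) n :
  uniq s -> 0 \in s ->
  count (fun t => last x0 t != 0) (seqs_of s n.+1) = (size s ^ n * (size s).-1)%N.
Proof.
move=> us s0; elim: n x0 => [|n IH] x0.
  rewrite expn0 mul1n -(count_predC (pred1 0) s) count_uniq_mem // s0 add1n /=.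
  rewrite count_flatten -map_comp sumnE big_map -sum1_count.
  rewrite [RHS]big_mkcond; apply: eq_bigr => x _ /=.
  by rewrite addn0; case: (x == 0).
rewrite -[seqs_of s n.+2]/[seq x :: t | x <- s, t <- seqs_of s n.+1].
rewrite count_flatten -map_comp sumnE big_map.
rewrite (eq_bigr (fun=> (size s ^ n * (size s).-1)%N)) => [|x _].
  by rewrite big_const_seq count_predT iter_addn_0 expnS [RHS]mulnC -!mulnA; nia.
by rewrite -(IH x); move: (seqs_of s n.+1) => T; rewrite /= count_map.
Qed.

(** With [Q = q ^ m], the factor [c i] counts the tuples of length [i] with nonzero last entry, and
    [l.+1 - i] the exponents [l1] from [i] to [l]. The partial sums of [c] telescope to powers of
    [Q], so the weighted sum is geometric. *)
Lemma sum_last_neq0 Q l : (0 < Q)%N ->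
  ((\sum_(i < l.+1)
    (if i : nat is j.+1 then Q ^ j * (Q - 1) else 1) * (l.+1 - i)) * (Q - 1)
   = Q ^ l.+1 - 1)%N.
Proof.
move=> Q0.
pose c i := (if i is j.+1 then Q ^ j * (Q - 1) else 1)%N.
have T n : (\sum_(i < n.+1) c i = Q ^ n)%N.
  elim: n => [|n IH]; first by rewrite big_ord1.
  by rewrite big_ord_recr IH /= expnSr mulnBr muln1 subnKC // leq_pmulr.
rewrite -[LHS]/((\sum_(i < l.+1) c i * (l.+1 - i)) * (Q - 1))%N.
elim: l => [|l IH]; first by rewrite big_ord1 expn1 !mul1n.
(* Raising [l] by one adds each [c i] once more, in total the partial sum [Q ^ l.+1]. *)
have -> : (\sum_(i < l.+2) c i * (l.+2 - i) =
           \sum_(i < l.+1) c i * (l.+1 - i) + Q ^ l.+1)%N.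
  have T' := T l.+1; rewrite big_ord_recr /= in T'.
  rewrite big_ord_recr /= -T' addnA -big_split /=.
  rewrite subSnn muln1; congr (_ + _)%N; apply: eq_bigr => -[i Hi] _ /=.
  by rewrite (subSn (ltnW Hi)) mulnS addnC.
rewrite mulnDl IH [in RHS]expnSr mulnBr muln1.
have : (0 < Q ^ l.+1)%N by rewrite expn_gt0 Q0.
have : (Q ^ l.+1 <= Q ^ l.+1 * Q)%N by rewrite leq_pmulr.
by lia.
Qed.

Section Indices.
Variables (F : finFieldType) (L : fieldExtType F).
Local Notation q := #|F|.
Local Notation K := (fL L).

(** The default [1] makes [last 1 alpha != 0] hold for the empty tuple as well, and [l0] is
    recovered as [size alpha]. *)
Lemma mem_block_indices p m (alpha : seq K) a j l1 :
  (alpha, a, j, l1) \in block_indices L p m ->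
  [/\ all (fun x => x \in subF L m) alpha, last 1 alpha != 0, a \in subF L m,
      (j < q - 1)%N & (size alpha <= l1 <= (p - 3) %/ 2)%N].
Proof.
case/flattenP => s /mapP [l0]; rewrite mem_iota add0n ltnS => Hl0 ->.
case/allpairsP => -[hb l1'] /= [/allpairsP [[ha j'] /= [/allpairsP [[al a'] /=]]]].
rewrite !mem_filter mem_seqs_of => -[/andP [Hlast /andP [/eqP sz Hal]]].
move=> /andP [Ha' _] ->; rewrite !mem_iota => /andP [_ Hj] -> Hl1 [-> -> -> ->].
split=> //.
- apply/allP => x /(allP Hal); rewrite /= mem_filter => /andP [] //.
- by case/orP: Hlast => // /eqP ->; rewrite oner_eq0.
- move: Hl1; rewrite -[_ :: _]/(iota l0 ((p - 3) %/ 2 - l0).+1) mem_iota sz.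
  by case/andP => -> H; move: (_ %/ 2)%N Hl0 H => l Hl0 H; lia.
Qed.

Lemma block_indices_mem p m (alpha : seq K) a j l1 :
  all (fun x => x \in subF L m) alpha -> last 1 alpha != 0 -> a \in subF L m ->
  (j < q - 1)%N -> (size alpha <= l1 <= (p - 3) %/ 2)%N ->
  (alpha, a, j, l1) \in block_indices L p m.
Proof.
move=> Hal Hlast Ha Hj /andP [Hs Hl]; apply/flattenP.
eexists; first by apply/mapP; exists (size alpha); [rewrite mem_iota /=; lia | reflexivity].
apply/allpairsP; exists ((alpha, a, j), l1); split=> //; last first.
  rewrite mem_iota /= Hs /=; move: (_ %/ 2)%N Hl => l Hl; lia.
apply/allpairsP; exists ((alpha, a), j); split=> //; last by rewrite mem_iota /= add0n.
apply/allpairsP; exists (alpha, a); split=> //.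
  rewrite mem_filter Hlast orbT mem_seqs_of eqxx /=.
  by apply/allP => x /(allP Hal) Hx; rewrite /= mem_filter Hx mem_enum.
by rewrite mem_filter /= Ha mem_enum.
Qed.

Lemma block_indices_uniq p m : uniq (block_indices L p m).
Proof.
rewrite /block_indices; set l := (_ %/ 2)%N; set Km := [seq _ <- _ | _].
have uKm : uniq Km by rewrite filter_uniq ?enum_uniq.
(* The trivial map [f] gives the outer concatenation the shape of a dependent product; it is
   injective on it because [l0] is the length of the tuple [alpha]. *)
pose f (l0 : nat) (h : (seq K * K * nat * nat)) := h.
rewrite (_ : [seq _ | l0 <- iota 0 l.+1] =
  [seq [seq f l0 h | h <- [seq (hb, l1) | hb <- [seq (ha, j) | ha <- [seq (alpha, a) |
                      alpha <- [seq al <- seqs_of Km l0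
                               | (al == [::]) || (last 1 al != 0)],
                      a <- Km], j <- iota 0 (q - 1)],
                    l1 <- iota l0 (l - l0).+1]] | l0 <- iota 0 l.+1]); last first.
  by apply: eq_map => l0; rewrite map_id.
apply: allpairs_uniq_dep; first exact: iota_uniq.
  move=> l0 _; apply: allpairs_uniq; rewrite ?iota_uniq //; last by case=> [? ?] [? ?] _ _ [-> ->].
  apply: allpairs_uniq; rewrite ?iota_uniq //; last by case=> [? ?] [? ?] _ _ [-> ->].
  apply: allpairs_uniq => //; last by case=> [? ?] [? ?] _ _ [-> ->].
  by rewrite filter_uniq // seqs_of_uniq.
have key t : t \in [seq @Tagged _ x (fun _ => (seq K * K * nat * nat)%type) y | x <- iota 0 l.+1,
   y <- [seq (hb, l1) | hb <- [seq (ha, j) | ha <- [seq (alpha, a) |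
                      alpha <- [seq al <- seqs_of Km x
                               | (al == [::]) || (last 1 al != 0)],
                      a <- Km], j <- iota 0 (q - 1)],
                    l1 <- iota x (l - x).+1]] -> tag t = size (tagged t).1.1.1.
  move/allpairsPdep => [l0 [h [_ Hh ->]]] {t}.
  case/allpairsP: Hh => -[hb l1'] [/allpairsP [[ha j']
    [/allpairsP [[al a'] [Hal _ ->]] _ ->]] _ ->] /=.
  move: Hal; rewrite mem_filter mem_seqs_of => /and3P [_ /eqP E _].
  by rewrite -E.
move=> [l0 h] [l0' h'] /key /= E /key /= E' /= H.
by move: H E E'; rewrite /f => -> -> ->.
Qed.

(** The factors [q ^ m] and [q - 1] count [a] and [j]; the geometric sum counts the pairs
    [(alpha, l1)]. Multiplying by [q ^ m - 1] avoids a quotient. *)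
Lemma size_block_indices p m : (0 < m)%N -> (m %| \dim {:L})%N ->
  (size (block_indices L p m) * (q ^ m - 1))%N =
  (q ^ m * (q - 1) * (q ^ (((p - 3) %/ 2).+1 * m) - 1))%N.
Proof.
move=> m0 mL.
rewrite /block_indices; set l := (_ %/ 2)%N; set Km := [seq _ <- _ | _].
pose Q := (q ^ m)%N.
have Q0 : (0 < Q)%N by rewrite expn_gt0 (ltnW (finNzRing_gt1 F)).
have sKm : size Km = Q.
  rewrite /Q -[in RHS](dim_subF m0 mL) -(card_vspace (T := K)).
  rewrite -(card_uniqP _); last exact/filter_uniq/enum_uniq.
  by apply: eq_card => x; rewrite mem_filter mem_enum andbT.
have sal l0 : size [seq al <- seqs_of Km l0 | (al == [::]) || (last 1 al != 0)] =
   (if l0 is l0'.+1 then size Km ^ l0' * (size Km).-1 else 1)%N.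
  case: l0 => [|l0] //; rewrite -(count_last_neq0 (1 : K)).
  - by rewrite -size_filter; congr size; apply: eq_in_filter => -[|x t]; rewrite ?mem_seqs_of.
  - exact/filter_uniq/enum_uniq.
  - by rewrite mem_filter mem0v mem_enum.
rewrite size_flatten /shape -map_comp sumnE big_map.
transitivity ((\sum_(l0 < l.+1)
  ((if l0 : nat is l0'.+1 then Q ^ l0' * (Q - 1) else 1) * (l.+1 - l0)))
  * (Q - 1) * (Q * (q - 1)))%N.
  rewrite -/Q -[iota 0 _]/(index_iota 0 l.+1) big_mkord !big_distrl; apply: eq_bigr => i _.
  rewrite /comp !size_allpairs sal !size_iota sKm -subn1 -(subSn (_ : i <= l)%N) -1?ltnS //.
  by rewrite -/Q /=; case: (nat_of_ord i) => [|j]; ring.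
rewrite sum_last_neq0 // -expnM [(m * _)%N]mulnC -/Q.
by rewrite mulnC.
Qed.
End Indices.

(** Here [U1], [V1], [LA] stand for the [q]-th powers of [u1], [v1], [la], and likewise for index 2.
    Each expression is a multiple of the determinant [D]: they equal [c la D], [- c' LA D] and
    [c c' D (a' la - a LA)], so [D] cancels. *)
Lemma twist_solve (R : fieldType) (u1 u2 v1 v2 U1 U2 V1 V2 la LA c c' a a' : R) :
  V1 = LA * U1 -> V2 = LA * U2 -> v1 = la * u1 -> v2 = la * u2 ->
  la != 0 -> LA != 0 -> c != 0 -> c' != 0 -> U1 * u2 - U2 * u1 != 0 ->
  let f1 := c * (U1 + a * u1) in let f2 := c * (U2 + a * u2) in
  let g1 := c' * (V1 + a' * v1) in let g2 := c' * (V2 + a' * v2) in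
  [/\ f1 * v2 - f2 * v1 != 0, u1 * g2 - u2 * g1 != 0,
      f1 * v2 - f2 * v1 + (u1 * g2 - u2 * g1) = 0 -> c * la = c' * LA &
      f1 * g2 = f2 * g1 -> a' * la = a * LA].
Proof.
move=> -> -> -> -> la0 LA0 c0 c'0 D0 /=; set D := _ - _ in D0.
have -> : c * (U1 + a * u1) * (la * u2) - c * (U2 + a * u2) * (la * u1) = c * la * D.
  by rewrite /D; ring.
have -> : u1 * (c' * (LA * U2 + a' * (la * u2))) -
  u2 * (c' * (LA * U1 + a' * (la * u1))) = - (c' * LA * D).
  by rewrite /D; ring.
rewrite oppr_eq0 !mulf_neq0 //; split=> //.
  by move/eqP; rewrite subr_eq0 => /eqP /(mulIf D0).
move/eqP; rewrite -subr_eq0.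
have -> : c * (U1 + a * u1) * (c' * (LA * U2 + a' * (la * u2))) -
  c * (U2 + a * u2) * (c' * (LA * U1 + a' * (la * u1))) = c * c' * D * (a' * la - a * LA).
  by rewrite /D; ring.
by rewrite !mulf_eq0 (negPf c0) (negPf c'0) (negPf D0) /= subr_eq0 => /eqP.
Qed.

(** The source of the bound [l = (p - 3) / 2]: two factors of degree at most [l + 1] have a product
    of degree at most [2 l + 2 = p - 1]. *)
Lemma size_product_bound p s t : odd p -> (3 <= p)%N ->
  (s <= ((p - 3) %/ 2).+2 -> t <= ((p - 3) %/ 2).+2 -> (s + t).-1 <= p)%N.
Proof. by lia. Qed.

(** * The maps [Phi] and the rigidity of their images *)

Section ImagePhi.
Variables (F : finFieldType) (L : fieldExtType F).
Local Notation q := #|F|.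
Local Notation K := (fL L).

Lemma Phi_is_linear (w g : K) h : linear (Phi w g h).
Proof.
case: h => [[[alpha a] j] l1] c x y /=.
have -> : (c *: x + y) ^+ q = c *: x ^+ q + y ^+ q.
  have := exprD_card 1 (c *: x) y; rewrite expn1 => ->.
  by have := exprZ_card 1 c x; rewrite expn1 => ->.
rewrite -(mulr_algl c x) -(mulr_algl c (x ^+ q)) -[in RHS](mulr_algl c (_ + _)).
by ring.
Qed.

HB.instance Definition _ (w g : K) h :=
  GRing.isLinear.Build F K K *:%R (Phi w g h) (Phi_is_linear w g h).

Lemma imgvE (f : {linear K -> K}) (U : {vspace K}) : imgv f U = (linfun f @: U)%VS.
Proof.
rewrite /imgv -[in RHS](_ : <<[seq u <- enum K | u \in U]>>%VS = U).
  by rewrite limg_span; congr span; apply: eq_map => u; rewrite lfunE.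
apply/eqP; rewrite eqEsubv; apply/andP; split; apply/subvP => u.
  by apply/subvP/span_subvP => x; rewrite mem_filter => /andP [].
by move=> Hu; apply: memv_span; rewrite mem_filter Hu mem_enum.
Qed.

Lemma memv_imgvP (f : {linear K -> K}) (U : {vspace K}) x :
  reflect (exists2 u, u \in U & x = f u) (x \in imgv f U).
Proof.
rewrite imgvE; apply: (iffP memv_imgP) => -[u Hu ->]; exists u => //;
by rewrite lfunE.
Qed.

Lemma dim_imgv (f : {linear K -> K}) (U : {vspace K}) :
  (forall u, u \in U -> f u = 0 -> u = 0) -> \dim (imgv f U) = \dim U.
Proof.
move=> Hf; rewrite imgvE limg_dim_eq //; apply/eqP; rewrite -subv0.
apply/subvP => u; rewrite memv_cap memv_ker lfunE memv0 /= => /andP [Hu /eqP H0].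
by rewrite (Hf u).
Qed.

(** The fixed field of Frobenius contains [1] and has dimension 1 over [F], so it consists of the
    scalars. *)
Lemma subF1E (x : K) : x ^+ q = x -> exists c : F, x = c%:A.
Proof.
move=> Hx; have : x \in subF L 1 by rewrite subFE expn1 Hx.
have -> : subF L 1 = 1%VS.
  apply/eqP; rewrite eq_sym eqEdim sub1v dimv1 dim_subF ?dvd1n //.
  by case/vlineP => c ->; exists c.
Qed.

(** [Phi] with an indeterminate in place of [g], so that relations between values of [Phi] can be
    lifted to polynomials. *)
Definition Phi_poly (w : K) (h : seq K * K * nat * nat) (u : K) : {poly K} :=
  let: (alpha, a, j, l1) := h in
  u *: Poly (1 :: alpha) + (w ^+ j * (u ^+ q + a * u)) *: 'X^(l1.+1).

Lemma horner_Phi_poly w g h u : (Phi_poly w h u).[g] = Phi w g h u.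
Proof.
case: h => [[[alpha a] j] l1]; rewrite /Phi_poly /Phi /Palpha hornerD !hornerZ hornerXn.
congr (_ * _ + _).
rewrite (@horner_coef_wide _ (size alpha).+1) ?(leq_trans (size_Poly _)) //.
rewrite big_ord_recl coef_Poly expr0 mulr1; congr (_ + _).
by apply: eq_bigr => i _; rewrite coef_Poly.
Qed.

Section Level.
Variables (p m : nat) (w g : K).
Hypotheses (p_odd : odd p) (p_ge3 : (3 <= p)%N) (m_gt0 : (0 < m)%N).
Hypothesis m_dvd : (m %| \dim {:L})%N.
Hypothesis pm_dvd : (p * m %| \dim {:L})%N.
Hypothesis w_prim : (q ^ m - 1).-primitive_root w.
Hypothesis gen_g : <<subF L m; g>>%VS = subF L (p * m).
Local Notation E := (subF L m).
Local Notation l := ((p - 3) %/ 2)%N.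
Implicit Types h : seq K * K * nat * nat.

(** Comparing dimensions [p * m] and [m] shows that [g] has degree [p] over [E], hence no nonzero
    polynomial over [E] of smaller degree vanishes at [g]. *)
Lemma small_root (P : {poly K}) :
  P \is a polyOver E -> (size P <= p)%N -> P.[g] = 0 -> P = 0.
Proof.
have degg : adjoin_degree E g = p.
  have p_gt0 : (0 < p)%N by rewrite (leq_trans _ p_ge3).
  have := dim_Fadjoin [the {subfield K} of E] g.
  rewrite gen_g (dim_subF _ pm_dvd) ?muln_gt0 ?p_gt0 //= (dim_subF m_gt0 m_dvd).
  by move/eqP; rewrite eqn_pmul2r // => /eqP.
move=> PE; rewrite -degg => sP Pg.
by apply/eqP; rewrite -(root_small_adjoin_poly PE sP); apply/eqP.
Qed.

Lemma w_in : w \in E.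
Proof.
have := prim_expr_order w_prim; rewrite subFE => H.
have q0 : (0 < q ^ m)%N by rewrite expn_gt0 (ltnW (finNzRing_gt1 F)).
by rewrite -(subnK q0) addn1 exprS H mulr1.
Qed.

Lemma Phi_poly_over h u : h \in block_indices L p m -> u \in E ->
  Phi_poly w h u \is a polyOver E.
Proof.
case: h => [[[alpha a] j] l1] /mem_block_indices [Hal _ Ha _ _] Hu.
rewrite /Phi_poly rpredD // polyOverZ ?polyOverXn //; last first.
  by rewrite rpredM ?rpredX ?w_in // rpredD ?rpredX ?rpredM.
apply/polyOverP => i; rewrite coef_Poly; case: i => [|i] /=; first exact: rpred1.
case: (ltnP i (size alpha)) => Hi; last by rewrite nth_default // rpred0.
exact: (allP Hal) (mem_nth _ Hi).
Qed.

Lemma size_Phi_poly h u : h \in block_indices L p m -> (size (Phi_poly w h u) <= l.+2)%N.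
Proof.
case: h => [[[alpha a] j] l1] /mem_block_indices [_ _ _ _ /andP [H1 H2]].
apply: leq_trans (size_polyD _ _) _; rewrite geq_max; apply/andP; split.
  apply: leq_trans (size_scale_leq _ _) _; apply: leq_trans (size_Poly _) _.
  by rewrite /= ltnS (leq_trans H1) // (leq_trans H2).
by apply: leq_trans (size_scale_leq _ _) _; rewrite size_polyXn !ltnS.
Qed.

Lemma Phi_poly0 h u : (Phi_poly w h u)`_0 = u.
Proof.
by case: h => [[[alpha a] j] l1]; rewrite coefD !coefZ coef_Poly coefXn /= mulr0 addr0 mulr1.
Qed.

(** [u] is the constant coefficient of a polynomial of degree below [p] that vanishes at [g]. *)
Lemma Phi_inj0 h u : h \in block_indices L p m -> u \in E ->
  Phi w g h u = 0 -> u = 0.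
Proof.
move=> Hh Hu; rewrite -horner_Phi_poly => H0.
rewrite -(Phi_poly0 h u) (small_root (Phi_poly_over Hh Hu) _ H0) ?coef0 //.
by apply: leq_trans (size_Phi_poly _ Hh) _; lia.
Qed.

(** The relation reads [w ^+ j = w ^+ j' * la ^+ (q - 1)]. Raising it to [N = (q^m - 1) / (q - 1)]
    kills the power of [la], while [w ^+ N] has order [q - 1], which separates the exponents below
    [q - 1]. *)
Lemma twist_eq (la : K) (j j' : nat) :
  la != 0 -> la \in E -> (j < q - 1)%N -> (j' < q - 1)%N ->
  w ^+ j * la = w ^+ j' * la ^+ q -> j = j' /\ la ^+ q = la.
Proof.
move=> la0 laE Hj Hj' H.
have q1 := finNzRing_gt1 F.
pose N := (\sum_(i < m) q ^ i)%N.
have HN : (q ^ m - 1 = (q - 1) * N)%N by rewrite !subn1 predn_exp.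
have N0 : (0 < N)%N.
  have : (0 < q ^ m - 1)%N by rewrite subn_gt0 -(exp1n m) ltn_exp2r.
  by rewrite HN muln_gt0 => /andP [].
have qm0 : (0 < q ^ m)%N by rewrite expn_gt0 (ltnW q1).
have laN : la ^+ ((q - 1) * N) = 1.
  apply: (mulfI la0); rewrite -HN -exprS mulr1 subn1 prednK //.
  by apply/eqP; rewrite -subFE.
have laq : la ^+ q = la ^+ (q - 1) * la by rewrite -exprSr subn1 prednK // ltnW.
have H' : w ^+ j = w ^+ j' * la ^+ (q - 1).
  by apply: (mulIf la0); rewrite H laq mulrA.
have jj' : j = j'.
  have := congr1 (fun x => x ^+ N) H'; rewrite exprMn -!exprM laN mulr1 => /eqP.
  rewrite (eq_prim_root_expr w_prim) HN !modn_small ?ltn_pmul2r //.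
  by rewrite eqn_pmul2r // => /eqP.
split=> //; subst j'.
apply: (@mulfI _ (w ^+ j)); last by rewrite -H.
by rewrite expf_neq0 // (prim_root_eq0 w_prim) HN -lt0n muln_gt0 N0 subn_gt0 q1.
Qed.

(** The inequation on [u1] and [u2] encodes their independence over [F]: it says that [u2 / u1] is
    not fixed by Frobenius. *)
Lemma Phi_key h h' (b u1 u2 v1 v2 : K) :
  h \in block_indices L p m -> h' \in block_indices L p m ->
  u1 \in E -> u2 \in E -> v1 \in E -> v2 \in E ->
  u1 ^+ q * u2 != u2 ^+ q * u1 ->
  Phi w g h u1 = b * Phi w g h' v1 -> Phi w g h u2 = b * Phi w g h' v2 ->
  h = h' /\ exists c : F, b = c%:A.
Proof.
move=> Hh Hh' Hu1 Hu2 Hv1 Hv2 D0 e1 e2.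
have u10 : u1 != 0.
  apply: contraNneq D0 => ->.
  by rewrite mulr0 expr0n gtn_eqF ?mul0r // ltnW // finNzRing_gt1.
have u20 : u2 != 0.
  apply: contraNneq D0 => ->.
  by rewrite mulr0 expr0n gtn_eqF ?mul0r // ltnW // finNzRing_gt1.
have v10 : v1 != 0.
  apply: contra_neq u10 => v10; move: e1; rewrite v10 linear0 mulr0.
  exact: Phi_inj0.
have cross : Phi_poly w h u1 * Phi_poly w h' v2 = Phi_poly w h u2 * Phi_poly w h' v1.
  apply/eqP; rewrite -subr_eq0; apply/eqP; apply: small_root.
  - by rewrite rpredB // rpredM ?Phi_poly_over.
  - apply: leq_trans (size_polyD _ _) _; rewrite size_polyN geq_max.
    have sM x y : (size (Phi_poly w h x * Phi_poly w h' y)%R <= p)%N.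
      apply: leq_trans (size_polyMleq _ _) _.
      by apply: size_product_bound; rewrite ?size_Phi_poly.
    by rewrite !sM.
  - by rewrite !hornerE !horner_Phi_poly e1 e2 mulrAC subrr.
move: Hh Hh' e1 e2 cross.
case: h => [[[al a] j] l1]; case: h' => [[[al' a'] j'] l1'] Hh Hh' e1 e2 cross.
have [Hal Hlast Ha Hj /andP [Hs Hl]] := mem_block_indices Hh.
have [Hal' Hlast' Ha' Hj' /andP [Hs' Hl']] := mem_block_indices Hh'.
have [] := cross_product_eq _ _ _ _ cross; rewrite ?coef_Poly //.
- by apply: leq_trans (size_Poly _) _.
- by apply: leq_trans (size_Poly _) _.
move=> e12; pose la := v1 / u1.
have ev1 : v1 = la * u1 by rewrite divfK.
have ev2 : v2 = la * u2.
  by apply: (mulfI u10); rewrite e12 ev1 mulrCA [RHS]mulrCA [u2 * u1]mulrC.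
have la0 : la != 0 by rewrite mulf_neq0 ?invr_neq0.
have laE : la \in E by rewrite rpred_div.
have wj0 i : w ^+ i != 0.
  rewrite expf_neq0 // (prim_root_eq0 w_prim) -lt0n.
  exact: prim_order_gt0 w_prim.
have D0' : u1 ^+ q * u2 - u2 ^+ q * u1 != 0 by rewrite subr_eq0.
have V1 : v1 ^+ q = la ^+ q * u1 ^+ q by rewrite ev1 exprMn.
have V2 : v2 ^+ q = la ^+ q * u2 ^+ q by rewrite ev2 exprMn.
have laq0 : la ^+ q != 0 by rewrite expf_neq0.
have [A0 B0 sumAB prodAB] :=
  twist_solve a a' V1 V2 ev1 ev2 la0 laq0 (wj0 j) (wj0 j') D0'.
move=> /(_ A0 B0) [[el1] eP /sumAB clc' /prodAB ea].
have [ej elaq] := twist_eq la0 laE Hj Hj' clc'.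
(* The nonzero last entry keeps [Poly] from trimming [1 :: al], so equal polynomials come from equal
   tuples. *)
have eal : al = al'.
  have := congr1 polyseq eP.
  by rewrite !(@PolyK _ 0) // => -[].
have eaa : a = a'.
  by apply/esym/(mulIf la0); rewrite ea elaq.
subst al' a' j' l1'; split=> //.
have [c ec] := subF1E elaq.
(* Since [v1 = c u1] with [c] in [F], linearity turns the first relation into
   [Phi u1 = b c Phi u1]. *)
exists c^-1.
have ph0 : Phi w g (al, a, j, l1) u1 != 0 by apply: contra_neq u10; apply: Phi_inj0.
have c0 : c != 0 by apply: contraNneq la0 => c0; rewrite ec c0 scale0r.
have e3 : Phi w g (al, a, j, l1) v1 = c *: Phi w g (al, a, j, l1) u1.
  by rewrite ev1 ec mulr_algl linearZ.
apply: (mulIf ph0); rewrite mulr_algl [in RHS]e1 e3 -scalerAr scalerA mulVf ?scale1r //.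
Qed.
End Level.
End ImagePhi.

(** The fibres partition [s]. This counts codewords through their parameters [(h, U, b)], each word
    having equally many. *)
Lemma size_undup_map_fibers (T T' : eqType) (f : T -> T') (s : seq T) d :
  (forall x, x \in s -> count (fun y => f y == f x) s = d) ->
  (size (undup (map f s)) * d = size s)%N.
Proof.
move=> Hd; rewrite -(size_map f s) -(perm_size (perm_count_undup (map f s))).
rewrite size_flatten /shape -map_comp.
rewrite (@eq_in_map _ _ _ (fun=> d) _).1; last first.
  move=> y; rewrite mem_undup /= size_nseq => /mapP [x xs ->].
  by rewrite -(Hd x xs) count_map.
by rewrite sumnE big_map big_const_seq count_predT iter_addn_0 mulnC.
Qed.

Lemma size_undup_eq_mem (T : eqType) (s t : seq T) :
  s =i t -> size (undup s) = size (undup t).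
Proof.
move=> st; apply/perm_size/uniq_perm; rewrite ?undup_uniq // => x.
by rewrite !mem_undup st.
Qed.

Lemma indep_pair (K : fieldType) (vT : vectType K) (X : {vspace vT}) :
  (2 <= \dim X)%N -> exists x1 x2, [/\ x1 \in X, x2 \in X, x1 != 0 & x2 \notin <[x1]>%VS].
Proof.
move=> dX; exists (vpick X).
have p0 : vpick X != 0 by rewrite vpick0 -dimv_eq0 -lt0n (leq_trans _ dX).
have /subvPn [x2 x2X x2n] : ~~ (X <= <[vpick X]>)%VS.
  by apply: contraL dX => /dimvS; rewrite dim_vline p0 -ltnNge ltnS.
by exists x2; rewrite memv_pick.
Qed.

(** * One nesting step: intersections, orbits and cardinality *)

Section Codewords.
Variables (F : finFieldType) (L : fieldExtType F).
Local Notation q := #|F|.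
Local Notation K := (fL L).

Lemma memv_scaleP (b x : K) (V : {vspace K}) :
  reflect (exists2 v, v \in V & x = b * v) (x \in (<[b]> * V)%VS).
Proof.
rewrite prodvC; apply: (iffP memv_cosetP) => -[v Hv ->]; exists v => //;
by rewrite mulrC.
Qed.

Lemma dim_scalev (b : K) (V : {vspace K}) : b != 0 -> \dim (<[b]> * V) = \dim V.
Proof. by move=> b0; rewrite prodvC dim_cosetv. Qed.

Lemma scalevM (b b' : K) (V : {vspace K}) :
  (<[b]> * (<[b']> * V) = <[b * b']> * V)%VS.
Proof.
apply/vspaceP => x; apply/memv_scaleP/memv_scaleP.
  by move=> [y /memv_scaleP [v Hv ->] ->]; exists v; rewrite ?mulrA.
by move=> [v Hv ->]; exists (b' * v); [apply/memv_scaleP; exists v | rewrite mulrA].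
Qed.

Definition codeword (w g : K) (x : seq K * K * nat * nat * {vspace K} * K) : {vspace K} :=
  (<[x.2]> * imgv (Phi w g x.1.1) x.1.2)%VS.

(** The invariant carried through the levels. Its last clause bounds the intersection of distinct
    words by dimension 1, that is, their distance from below by [2k - 2]. *)
Definition spread_code k m (C : seq {vspace K}) :=
  [/\ C != [::], {in C, forall U, (U <= subF L m)%VS /\ \dim U = k} &
      {in C &, forall U V, (2 <= \dim (U :&: V))%N -> U = V}].

(** The clauses express cyclicity, orbits of full length (stabilizers are reduced to scalars of
    [F]), and the presence of two different orbits. *)
Definition multi_cyclic m (C : seq {vspace K}) :=
  [/\ forall U b, U \in C -> b \in subF L m -> b != 0 -> (<[b]> * U)%VS \in C,
      forall U (b : K), U \in C -> b != 0 -> (<[b]> * U)%VS = U -> exists c : F, b = c%:A &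
      exists U V, [/\ U \in C, V \in C & forall b : K, b != 0 -> V != (<[b]> * U)%VS]].

(** The number of words that a level makes from each word below it: the number of indices times
    [(q^(pm) - 1) / (q - 1)], the length of a full orbit. *)
Definition block_size p m :=
  ((q ^ m * (q ^ (((p - 3) %/ 2).+1 * m) - 1) * (q ^ (p * m) - 1)) %/ (q ^ m - 1))%N.

Section Level.
Variables (p m : nat) (w g : K).
Hypotheses (p_odd : odd p) (p_ge3 : (3 <= p)%N) (m_gt0 : (0 < m)%N).
Hypothesis m_dvd : (m %| \dim {:L})%N.
Hypothesis pm_dvd : (p * m %| \dim {:L})%N.
Hypothesis w_prim : (q ^ m - 1).-primitive_root w.
Hypothesis gen_g : <<subF L m; g>>%VS = subF L (p * m).
Implicit Types (U V : {vspace K}) (b : K) (h : seq K * K * nat * nat).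
Local Notation E := (subF L m).
Local Notation ind := (block_indices L p m).

Let inj0 := Phi_inj0 p_odd p_ge3 m_gt0 m_dvd pm_dvd w_prim gen_g.

Lemma dim_codeword h U b : h \in ind -> (U <= E)%VS -> b != 0 ->
  \dim (codeword w g (h, U, b)) = \dim U.
Proof.
move=> Hh UE b0; rewrite dim_scalev // dim_imgv // => u Hu.
exact/inj0/(subvP UE).
Qed.

Lemma mem_codewordP h U b x :
  reflect (exists2 u, u \in U & x = b * Phi w g h u) (x \in codeword w g (h, U, b)).
Proof.
apply: (iffP (memv_scaleP _ _ _)) => /=.
  by move=> [y /memv_imgvP [u Hu ->] ->]; exists u.
by move=> [u Hu ->]; exists (Phi w g h u) => //; apply/memv_imgvP; exists u.
Qed.

Lemma codeword_sub h U b : h \in ind -> (U <= E)%VS -> b \in subF L (p * m) ->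
  (codeword w g (h, U, b) <= subF L (p * m))%VS.
Proof.
move=> Hh UE Hb; apply/subvP => x /mem_codewordP [u Hu ->].
suff HP : Phi w g h u \in subF L (p * m) by rewrite rpredM.
rewrite -horner_Phi_poly -gen_g mempx_Fadjoin //.
by apply: (Phi_poly_over w_prim Hh); apply: (subvP UE).
Qed.

Lemma codeword_meet h h' U U' b b' :
  h \in ind -> h' \in ind -> (U <= E)%VS -> (U' <= E)%VS -> b != 0 -> b' != 0 ->
  (2 <= \dim (codeword w g (h, U, b) :&: codeword w g (h', U', b')))%N ->
  [/\ h = h', (exists c : F, b' = c *: b) & (2 <= \dim (U :&: U'))%N].
Proof.
move=> Hh Hh' UE UE' b0 b'0 dX.
have [x1 [x2 []]] := indep_pair dX.
rewrite !memv_cap => /andP [/mem_codewordP [u1 Hu1 ex1] /mem_codewordP [v1 Hv1 ey1]].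
move=> /andP [/mem_codewordP [u2 Hu2 ex2] /mem_codewordP [v2 Hv2 ey2]] x10 x2n.
have Eu u : u \in U -> u \in E by apply: (subvP UE).
have Eu' u : u \in U' -> u \in E by apply: (subvP UE').
have u10 : u1 != 0 by apply: contraNneq x10 => u10; rewrite ex1 u10 linear0 mulr0.
(* Otherwise [u2 / u1] would be a scalar of [F], and [x2] a multiple of [x1]. *)
have D0 : u1 ^+ q * u2 != u2 ^+ q * u1.
  apply: contraNneq x2n => D0.
  have [c ec] : exists c : F, u2 / u1 = c%:A.
    apply: subF1E; rewrite expr_div_n; apply/eqP.
    by rewrite eqr_div ?expf_neq0 // -D0 mulrC.
  apply/vlineP; exists c.
  have -> : x2 = b * Phi w g h (c *: u1).
    by rewrite ex2 -(mulr_algl c u1) -ec divfK.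
  by rewrite linearZ /= -scalerAr ex1.
have key u v : b * Phi w g h u = b' * Phi w g h' v -> Phi w g h u = (b' / b) * Phi w g h' v.
  by move=> e; apply: (mulfI b0); rewrite e mulrA [b * _]mulrC divfK.
have [eh [c ec]] := Phi_key p_odd p_ge3 m_gt0 m_dvd pm_dvd w_prim gen_g Hh Hh'
  (Eu _ Hu1) (Eu _ Hu2) (Eu' _ Hv1) (Eu' _ Hv2) D0
  (key _ _ (etrans (esym ex1) ey1)) (key _ _ (etrans (esym ex2) ey2)).
have eb : b' = c *: b by rewrite -(mulr_algl c b) -ec divfK.
split=> //; first by exists c.
subst h'; apply: leq_trans dX _.
(* The intersection of the two words lies in the word built from [U :&: U']: a common vector has
   preimages [u] and [v] with [u = c v], by injectivity. *)
rewrite -(@dim_codeword h (U :&: U')%VS b) //; last by apply: subv_trans UE; apply: capvSl.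
apply/dimvS/subvP => x; rewrite memv_cap.
move=> /andP [/mem_codewordP [u Hu ex] /mem_codewordP [v Hv ey]].
apply/mem_codewordP; exists u => //; rewrite memv_cap Hu /=.
have uv : u = c *: v.
  apply/eqP; rewrite -subr_eq0; apply/eqP; apply: (inj0 Hh).
    by apply: rpredB; [apply: Eu | apply/rpredZ/Eu'].
  rewrite linearB linearZ /=; apply/eqP; rewrite subr_eq0; apply/eqP.
  by apply: (mulfI b0); rewrite -ex ey eb -scalerAl -scalerAr.
by rewrite uv rpredZ.
Qed.

Lemma mem_odotP (C : seq {vspace K}) V :
  reflect (exists x, [/\ x.1.1 \in ind, x.1.2 \in C, x.2 \in subF L (p * m), x.2 != 0
                       & V = codeword w g x])
          (V \in odot_block p m w g C).
Proof.
apply: (iffP flattenP) => [[s /allpairsP [[h U] /= [Hh HU ->]]]|].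
  case/mapP => b; rewrite mem_filter => /andP [/andP [Hb b0] _] ->.
  by exists (h, U, b).
move=> [[[h U] b] /= [Hh HU Hb b0 ->]]; exists (orbitv (subF L (p * m)) (imgv (Phi w g h) U)).
  by apply/allpairsP; exists (h, U).
by apply/mapP; exists b => //; rewrite mem_filter Hb b0 mem_enum.
Qed.

Section Step.
Variables (k : nat) (C : seq {vspace K}).
Hypotheses (k_ge2 : (2 <= k)%N) (HC : spread_code k m C).

(** A word of dimension [k >= 2] meets itself in dimension at least 2, so [codeword_meet]
    applies. *)
Lemma codeword_eq h h' U U' b b' : h \in ind -> h' \in ind -> U \in C -> U' \in C ->
  b != 0 -> b' != 0 ->
  codeword w g (h, U, b) = codeword w g (h', U', b') ->
  [/\ h = h', U = U' & exists c : F, b' = c *: b].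
Proof.
case: HC => _ HU HUV Hh Hh' UC UC' b0 b'0 e.
have [UE dU] := HU U UC; have [UE' dU'] := HU U' UC'.
have [|eh ec dUU'] := codeword_meet Hh Hh' UE UE' b0 b'0.
  by rewrite -e capvv dim_codeword // dU.
by split=> //; apply: HUV.
Qed.

Lemma odot_spread : spread_code k (p * m) (odot_block p m w g C).
Proof.
case: HC => C0 HU HUV; split.
- have [h Hh] : exists h, h \in ind.
    exists ([::], 0, 0%N, 0%N).
    by rewrite block_indices_mem ?oner_eq0 ?rpred0 ?subn_gt0 ?finNzRing_gt1.
  case: C C0 => // U C' _.
  have : codeword w g (h, U, 1) \in odot_block p m w g (U :: C').
    by apply/mem_odotP; exists (h, U, 1); rewrite Hh mem_head rpred1 oner_eq0.
  by case: (odot_block _ _ _ _ _).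
- move=> V /mem_odotP [[[h U] b] /= [Hh UC Hb b0 ->]].
  have [UE dU] := HU U UC.
  by rewrite codeword_sub // dim_codeword.
move=> V V' /mem_odotP [[[h U] b] /= [Hh UC Hb b0 ->]].
move=> /mem_odotP [[[h' U'] b'] /= [Hh' UC' Hb' b'0 ->]] dX.
have [UE dU] := HU U UC; have [UE' dU'] := HU U' UC'.
have [eh [c ec] dUU'] := codeword_meet Hh Hh' UE UE' b0 b'0 dX.
have eU := HUV _ _ UC UC' dUU'.
subst h' U' b'; apply/vspaceP => x.
have c0 : c != 0 by apply: contraNneq b'0 => ->; rewrite scale0r.
(* The scalar [c] can be absorbed into [U], so [b] and [c *: b] give the same word. *)
apply/mem_codewordP/mem_codewordP => -[u Hu ->].
  exists (c^-1 *: u); first by rewrite rpredZ.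
  by rewrite linearZ /= -scalerAr -scalerAl scalerA mulVf // scale1r.
exists (c *: u); first by rewrite rpredZ.
by rewrite linearZ /= -scalerAr -scalerAl.
Qed.

Lemma odot_multi_cyclic : multi_cyclic (p * m) (odot_block p m w g C).
Proof.
split.
- move=> V b /mem_odotP [[[h U] b'] /= [Hh UC Hb' b'0 ->]] Hb b0.
  apply/mem_odotP; exists (h, U, b * b'); split=> //=.
  + by rewrite rpredM.
  + by rewrite mulf_neq0.
  + by rewrite /codeword /= scalevM.
- move=> V b /mem_odotP [[[h U] b'] /= [Hh UC Hb' b'0 ->]] b0.
  rewrite /codeword /= scalevM => e.
  have bb'0 : b * b' != 0 by rewrite mulf_neq0.
  have [_ _ [c ec]] := @codeword_eq h h U U b' (b * b') Hh Hh UC UC b'0 bb'0 (esym e).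
  by exists c; apply: (mulIf b'0); rewrite ec mulr_algl.
have [C0 _ _] := HC.
have [U UC] : exists U, U \in C by case: C C0 => // U C' _; exists U; rewrite mem_head.
have j0 : (0 < q - 1)%N by rewrite subn_gt0 finNzRing_gt1.
(* Two indices that differ only in [a]; since a word determines its index whatever the factor [b],
   their orbits are different. *)
pose h : seq K * K * nat * nat := ([::], 0, 0%N, 0%N).
pose h' : seq K * K * nat * nat := ([::], 1, 0%N, 0%N).
have Hh : h \in ind by rewrite block_indices_mem ?oner_eq0 ?rpred0.
have Hh' : h' \in ind by rewrite block_indices_mem ?oner_eq0 ?rpred1.
exists (codeword w g (h, U, 1)), (codeword w g (h', U, 1)); split.
- by apply/mem_odotP; exists (h, U, 1); rewrite Hh UC rpred1 oner_eq0.
- by apply/mem_odotP; exists (h', U, 1); rewrite Hh' UC rpred1 oner_eq0.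
move=> b b0; apply/eqP; rewrite {2}/codeword /= scalevM mulr1 => e.
have [[/eqP]] := @codeword_eq h' h U U 1 b Hh' Hh UC UC (oner_neq0 _) b0 e.
by rewrite oner_eq0.
Qed.

(** The map from the parameters [(h, U, b)] to words has fibres of size [q - 1], because only [b] is
    ambiguous, up to a factor in [F^*]. *)
Lemma size_odot :
  (size (undup (odot_block p m w g C)) * (q - 1) =
   size ind * size (undup C) * (q ^ (p * m) - 1))%N.
Proof.
pose B := [seq b <- enum K | (b \in subF L (p * m)) && (b != 0)].
pose S := [seq (hU, b) | hU <- [seq (h, U) | h <- ind, U <- undup C], b <- B].
have memS h U b : ((h, U, b) \in S) = [&& h \in ind, U \in C, b \in subF L (p * m) & b != 0].
  apply/allpairsP/idP.
    case=> -[[h' U'] b'] /= [/allpairsP [[h'' U''] /= [Hh HU [-> ->]]] Hb [-> -> ->]].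
    by move: Hb HU; rewrite Hh mem_undup mem_filter => /andP [-> _] ->.
  case/and4P=> Hh HU Hb b0; exists ((h, U), b); split=> //=.
    by apply/allpairsP; exists (h, U); rewrite mem_undup.
  by rewrite mem_filter Hb b0 mem_enum.
have uB : uniq B by exact/filter_uniq/enum_uniq.
have uS : uniq S.
  apply: allpairs_uniq => //; last by move=> [? ?] [? ?] _ _ [-> ->].
  apply: allpairs_uniq; rewrite ?block_indices_uniq ?undup_uniq //.
  by move=> [? ?] [? ?] _ _ [-> ->].
have sB : size B = (q ^ (p * m) - 1)%N.
  have pm0 : (0 < p * m)%N by rewrite muln_gt0 m_gt0 (leq_trans _ p_ge3).
  rewrite -[in RHS](dim_subF pm0 pm_dvd) -(card_vspace (T := K)) subn1.
  rewrite -(card_uniqP uB) (cardD1 0 (mem (subF L (p * m)))) mem0v /=.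
  by apply: eq_card => x; rewrite mem_filter mem_enum !inE andbT andbC.
have sS : size S = (size ind * size (undup C) * size B)%N by rewrite !size_allpairs.
rewrite -sB -sS.
rewrite -(size_undup_map_fibers (f := codeword w g) (d := (q - 1)%N)).
  congr (_ * _)%N; apply: size_undup_eq_mem => V.
  apply/mem_odotP/mapP => [[[[h U] b] /= [Hh UC Hb b0 ->]]|[[[h U] b]]].
    by exists (h, U, b); rewrite ?memS ?Hh ?UC ?Hb.
  by rewrite memS => /and4P [Hh UC Hb b0] ->; exists (h, U, b).
move=> [[h U] b]; rewrite memS => /and4P [Hh UC Hb b0].
(* The fibre through [(h, U, b)]. *)
pose S' := [seq (h, U, c *: b) | c <- enum F & c != 0].
have sS' : size S' = (q - 1)%N.
  rewrite size_map -(card_uniqP _); last exact/filter_uniq/enum_uniq.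
  rewrite subn1.
  rewrite -(cardC1 (0 : F)); apply: eq_card => c.
  by rewrite mem_filter mem_enum andbT.
rewrite -sS' -size_filter; apply/perm_size/uniq_perm.
- by rewrite filter_uniq.
- rewrite map_inj_in_uniq; first exact/filter_uniq/enum_uniq.
  move=> c c' _ _ [] /eqP; rewrite -subr_eq0 -scalerBl.
  by rewrite scaler_eq0 (negPf b0) orbF subr_eq0 => /eqP.
move=> [[h' U'] b']; rewrite mem_filter memS.
apply/andP/mapP => [[/eqP e /and4P [Hh' UC' Hb' b'0]]|[c]].
  have [-> -> [c ec]] := codeword_eq Hh Hh' UC UC' b0 b'0 (esym e).
  exists c; last by rewrite ec.
  rewrite mem_filter mem_enum andbT; apply: contraNneq b'0 => c0.
  by rewrite ec c0 scale0r.
rewrite mem_filter => /andP [c0 _] [-> -> ->].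
rewrite Hh UC rpredZ //= scaler_eq0 negb_or c0 b0; split=> //.
apply/eqP/vspaceP => x; apply/mem_codewordP/mem_codewordP => -[u Hu ->].
  exists (c *: u); first by rewrite rpredZ.
  by rewrite linearZ /= -scalerAr -scalerAl.
exists (c^-1 *: u); first by rewrite rpredZ.
by rewrite linearZ /= -scalerAr -scalerAl scalerA mulVf // scale1r.
Qed.

Lemma size_odot_block_size :
  size (undup (odot_block p m w g C)) = (size (undup C) * block_size p m)%N.
Proof.
have q1 := finNzRing_gt1 F.
have Q1 : (0 < q ^ m - 1)%N by rewrite subn_gt0 (leq_ltn_trans m_gt0) // ltn_expl.
have q10 : (0 < q - 1)%N by rewrite subn_gt0.
(* This makes the natural-number quotient in [block_size] exact. *)
have dv : (q ^ m - 1 %| q ^ (p * m) - 1)%N.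
  by rewrite !subn1 mulnC expnM (predn_exp (q ^ m)) dvdn_mulr.
rewrite /block_size muln_divA; last by rewrite dvdn_mull.
apply/eqP; rewrite eqn_div //; last by rewrite !dvdn_mull.
have e1 := size_odot; have e2 := size_block_indices p m_gt0 m_dvd.
rewrite -(eqn_pmul2r q10); apply/eqP; rewrite mulnAC e1.
move: e2; move: (size ind) (size (undup C)) (q ^ m - 1)%N (q ^ (p * m) - 1)%N
  => H N S T eH.
transitivity (H * S * N * T)%N; first by ring.
by rewrite eH; ring.
Qed.

End Step.
End Level.
End Codewords.

(** * Chaining the levels *)

Definition top_degree m (lv : seq (nat * nat)) := foldl (fun m x => x.1 * m)%N m lv.

(** Each level must start from the degree reached by the levels below it. *)
Fixpoint tower m (lv : seq (nat * nat)) :=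
  if lv is (p, m') :: lv' then [/\ m' = m, odd p, (3 <= p)%N & tower (p * m)%N lv'] else True.

Lemma top_degree_cat m s1 s2 : top_degree m (s1 ++ s2) = top_degree (top_degree m s1) s2.
Proof. exact: foldl_cat. Qed.

Lemma tower_cat m s1 s2 : tower m s1 -> tower (top_degree m s1) s2 -> tower m (s1 ++ s2).
Proof. by elim: s1 m => //= -[p m'] s1 IH m [-> op p3 /IH H] /H; split. Qed.

Lemma dvdn_top_degree m lv : (m %| top_degree m lv)%N.
Proof.
elim: lv m => //= x lv IH m.
by apply: dvdn_trans (IH _); rewrite dvdn_mull.
Qed.

Lemma tower_block p N e : odd p -> (3 <= p)%N ->
  let s := [seq (p, p ^ i * N)%N | i <- iota 0 e] in
  tower N s /\ top_degree N s = (p ^ e * N)%N.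
Proof.
move=> op p3 /=.
(* The starting exponent is generalized so that the induction on [e] can shift it. *)
suff H i : let s := [seq (p, p ^ i * N)%N | i <- iota i e] in
   tower (p ^ i * N) s /\ top_degree (p ^ i * N) s = (p ^ (i + e) * N)%N.
  by have := H 0%N; rewrite expn0 mul1n.
elim: e i => [|e IH] i /=; first by rewrite addn0.
by have [] := IH i.+1; rewrite mulnA -expnS addnS addSn => H1 H2; do ![split].
Qed.

Lemma tower_levels ps es k : all (fun p => prime p && odd p) ps ->
  tower k (levels ps es k) /\ top_degree k (levels ps es k) = Nj ps es k (size ps).
Proof.
move=> Hps.
have N0 : Nj ps es k 0 = k by rewrite /Nj big_ord0 mul1n.
(* The statement is generalized to the levels of the last [n] primes, for an induction from the end
   of [ps]. *)
suff H n j : (j + n)%N = size ps ->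
  let s := flatten [seq [seq ((nth 0%N ps j), (nth 0%N ps j) ^ i * Nj ps es k j)%N
              | i <- iota 0 (nth 0%N es j)] | j <- iota j n] in
   tower (Nj ps es k j) s /\ top_degree (Nj ps es k j) s = Nj ps es k (size ps).
  by have := H (size ps) 0%N (add0n _); rewrite /= N0.
elim: n j => [|n IH] j; first by rewrite addn0 => ->.
rewrite addnS -addSn => Hj.
have jps : (j < size ps)%N by rewrite -Hj addSn ltnS leq_addr.
have /andP [pp op] := allP Hps _ (mem_nth 0%N jps).
have p3 : (3 <= nth 0%N ps j)%N by rewrite odd_prime_gt2.
have [T1 T2] := tower_block (Nj ps es k j) (nth 0%N es j) op p3.
have eN : (nth 0%N ps j ^ nth 0%N es j * Nj ps es k j)%N = Nj ps es k j.+1.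
  by rewrite /Nj big_ord_recr /= mulnCA mulnA.
have [T3 T4] := IH _ Hj.
move=> s; rewrite /s [iota j _]/= [map _ (_ :: _)]/= [flatten (_ :: _)]/=.
split; first by apply: tower_cat => //; rewrite T2 eN.
by rewrite top_degree_cat T2 eN T4.
Qed.

(** * Nested codes and their minimum distance *)

Section Nest.
Variables (F : finFieldType) (L : fieldExtType F).
Local Notation q := #|F|.
Local Notation K := (fL L).

(** Induction on the levels. The last conclusion is conditional because the initial code has a
    single word, hence a single orbit; one level turns any spread code into a multi-orbit one. *)
Lemma nest_spread k lv m (w g : nat -> K) t (C : seq {vspace K}) :
  (2 <= k)%N -> (0 < m)%N -> tower m lv -> (top_degree m lv %| \dim {:L})%N ->
  (forall i, (i < size lv)%N -> let pm := nth (0, 0)%N lv i in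
    (q ^ pm.2 - 1).-primitive_root (w (t + i)%N) /\
    <<subF L pm.2; g (t + i)%N>>%VS = subF L (pm.1 * pm.2)) ->
  spread_code k m C ->
  [/\ spread_code k (top_degree m lv) (nest lv w g t C),
      size (undup (nest lv w g t C)) =
        (size (undup C) * \prod_(x <- lv) block_size F x.1 x.2)%N &
      lv != [::] \/ multi_cyclic m C ->
      multi_cyclic (top_degree m lv) (nest lv w g t C)].
Proof.
move=> k2; elim: lv m t C => [|[p m'] lv IH] m t C m0.
  by move=> _ _ _ HC; rewrite big_nil muln1; split=> // -[].
move=> /= [-> op p3 tw] dv Hwg HC.
have /= [wp gp] := Hwg 0%N (ltn0Sn _); rewrite addn0 in wp gp.
have pmdv : (p * m %| \dim {:L})%N by apply: dvdn_trans dv; apply: dvdn_top_degree.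
have mdv : (m %| \dim {:L})%N by apply: dvdn_trans pmdv; rewrite dvdn_mull.
have pm0 : (0 < p * m)%N by rewrite muln_gt0 m0 (leq_trans _ p3).
have sp := odot_spread op p3 m0 mdv pmdv wp gp HC.
have mc := odot_multi_cyclic op p3 m0 mdv pmdv wp gp k2 HC.
have Hwg' i : (i < size lv)%N -> let pm := nth (0, 0)%N lv i in
    (q ^ pm.2 - 1).-primitive_root (w (t.+1 + i)%N) /\
    <<subF L pm.2; g (t.+1 + i)%N>>%VS = subF L (pm.1 * pm.2).
  by move=> Hi; have := Hwg i.+1 Hi; rewrite addnS addSn.
have [H1 H2 H3] := IH _ t.+1 _ pm0 tw dv Hwg' sp.
split=> //; last by move=> _; apply: H3; right.
rewrite H2 big_cons mulnA; congr (_ * _)%N.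
exact: (size_odot_block_size op p3 m0 mdv pmdv wp gp k2 HC).
Qed.

Lemma spread_subF k : (0 < k)%N -> (k %| \dim {:L})%N -> spread_code k k [:: subF L k].
Proof.
move=> k0 kd; split=> // [U|U V]; rewrite !inE => /eqP ->.
  by rewrite dim_subF.
by move=> /eqP ->.
Qed.

Lemma subF_dimf (x : K) : x \in subF L (\dim {:L}).
Proof. by rewrite subFE -card_fL expf_card. Qed.

Lemma sdistE (k : nat) (U V : {vspace K}) : \dim U = k -> \dim V = k ->
  sdist U V = (2 * k - 2 * \dim (U :&: V))%N.
Proof.
move=> dU dV; have := dimv_sum_cap U V; rewrite /sdist dU dV => e.
by rewrite mulSn mul1n -e; lia.
Qed.

Lemma spread_sdist k n (C : seq {vspace K}) U V :
  (2 <= k)%N -> spread_code k n C -> U \in C -> V \in C -> U != V ->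
  (2 * k - 2 <= sdist U V)%N.
Proof.
move=> k2 [_ HU HUV] UC VC UV.
have [_ dU] := HU U UC; have [_ dV] := HU V VC.
rewrite (sdistE dU dV) leq_sub2l //.
have : (\dim (U :&: V) < 2)%N by rewrite ltnNge; apply: contra UV => /(HUV _ _ UC VC) ->.
by case: (\dim _) => [|[]].
Qed.

Lemma spread_sdist_attained k (C : seq {vspace K}) : (2 <= k)%N ->
  spread_code k (\dim {:L}) C -> multi_cyclic (\dim {:L}) C ->
  exists U V, [/\ U \in C, V \in C, U != V & sdist U V = (2 * k - 2)%N].
Proof.
move=> k2 HC [cyc stab _]; case: (HC) => C0 HU HUV.
have [U UC] : exists U, U \in C.
  by case: C C0 {HC cyc stab HU HUV} => // U C' _; exists U; rewrite mem_head.
have [_ dU] := HU U UC.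
have [x1 [x2 [x1U x2U x10 x2n]]] :
  exists x1 x2, [/\ x1 \in U, x2 \in U, x1 != 0 & x2 \notin <[x1]>%VS].
  by apply: indep_pair; rewrite dU.
have x20 : x2 != 0 by apply: contraNneq x2n => ->; rewrite mem0v.
have b0 : x2 / x1 != 0 by rewrite mulf_neq0 ?invr_neq0.
exists U, (<[x2 / x1]> * U)%VS.
have VC := cyc U _ UC (subF_dimf _) b0.
have [_ dV] := HU _ VC.
(* If the two words were equal, the stabilizer clause would put [x2 / x1] in [F], against
   independence. *)
have UV : U != (<[x2 / x1]> * U)%VS.
  apply: contraNneq x2n => /esym /(stab _ _ UC b0) [c ec].
  by apply/vlineP; exists c; rewrite -(mulr_algl c) -ec divfK.
split=> //; apply/eqP; rewrite eqn_leq (spread_sdist k2 HC) // andbT.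
rewrite (sdistE dU dV) leq_sub2l // -[X in (X <= _)%N]muln1 leq_mul2l /=.
(* The nonzero vector [x2 = (x2 / x1) * x1] lies in both words, so they meet in dimension at least
   1. *)
rewrite lt0n dimv_eq0; apply: contraNneq x20 => e; rewrite -memv0 -e memv_cap x2U /=.
by apply/memv_scaleP; exists x1; rewrite ?divfK.
Qed.

End Nest.

(** * The cardinality formula and the final assembly *)

Lemma card_formulaE (F : finFieldType) ps es k :
  card_formula #|F| ps es k = (\prod_(x <- levels ps es k) block_size F x.1 x.2)%N.
Proof.
have io n : iota 0 n = index_iota 0 n by rewrite /index_iota subn0.
rewrite /levels big_flatten big_map io big_mkord.
apply: eq_bigr => j _; rewrite big_map.
rewrite io big_mkord.
apply: eq_bigr => i _.
by rewrite /= /block_size /Nj -!mulnA.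
Qed.

Theorem theorem3p15 (F : finFieldType) (L : fieldExtType F)
    (k : nat) (ps es : seq nat) (w g : nat -> fL L) :
  (2 <= k)%N ->
  (0 < size ps)%N ->
  all (fun p => prime p && odd p) ps ->
  sorted (fun a b => b < a)%N ps ->
  size es = size ps ->
  all (fun e => 0 < e)%N es ->
  \dim {:L} = (\prod_(j < size ps) (nth 0%N ps j) ^ (nth 0%N es j) * k)%N ->
  good_choices ps es k w g ->
  let C := nested_code ps es k w g in
  [/\ (forall U, U \in C -> \dim U = k),
      (forall U b, U \in C -> b != 0 -> (<[b]> * U)%VS \in C),
      (exists U V, [/\ U \in C, V \in C &
                      forall b : fL L, b != 0 -> V != (<[b]> * U)%VS]),
      size (undup C) = card_formula #|F| ps es k &
      ((forall U V, U \in C -> V \in C -> U != V -> (2 * k - 2 <= sdist U V)%N) /\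
      (exists U V, [/\ U \in C, V \in C, U != V & sdist U V = (2 * k - 2)%N]))].
Proof.
move=> k2 ps0 Hps _ ses es0 dimL Hwg C.
have [tw td] := tower_levels es k Hps.
(* The degree reached by the last level is that of [L], so the scalars of the last orbits range over
   all nonzero elements of [L]. *)
rewrite -[RHS]/(Nj ps es k (size ps)) -td in dimL.
have k0 : (0 < k)%N by rewrite (leq_trans _ k2).
have kd : (k %| \dim {:L})%N by rewrite dimL dvdn_top_degree.
have Hwg' i : (i < size (levels ps es k))%N -> let pm := nth (0, 0)%N (levels ps es k) i in
    (#|F| ^ pm.2 - 1).-primitive_root (w (0 + i)%N) /\
    <<subF L pm.2; g (0 + i)%N>>%VS = subF L (pm.1 * pm.2).
  by move=> Hi; have [? [? ?]] := Hwg i Hi.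
have td_dvd : (top_degree k (levels ps es k) %| \dim {:L})%N by rewrite dimL.
have [sp sz mc] := nest_spread k2 k0 tw td_dvd Hwg' (spread_subF k0 kd).
(* There is a first prime and its exponent is positive, so at least one level is performed, as the
   multi-orbit claim requires. *)
have lv0 : levels ps es k != [::].
  case: ps ps0 ses {Hps dimL Hwg C tw td Hwg' td_dvd sp sz mc} => // p ps _.
  by case: es es0 => // e es /= /andP [e0 _] _; case: e e0.
have {}mc := mc (or_introl lv0).
rewrite -dimL in sp mc.
have [cyc stab orb] := mc; have [_ HU _] := sp.
split.
- by move=> U /HU [].
- by move=> U b UC; apply: cyc => //; apply: subF_dimf.
- exact: orb.
- by rewrite card_formulaE sz undup_id // mul1n.
split; first by move=> U V; apply: (spread_sdist k2 sp).
exact: spread_sdist_attained k2 sp mc.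
Qed.
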